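(* Let $K$ be an algebraically closed field of characteristic not equal to $2$ and $3$. Let $E$ be an alternative algebra over $K$, $A$ an alternative subalgebra of $E$, $B$ an $A$-complement of $E$, and $(A,B)$ the associated matched pair. Then $\sim$ is an equivalence relation on the set $\mathcal{DM}(B,A)$ of deformation maps, and the map $$\mathcal{HC}^2(B,A):=\mathcal{DM}(B,A)/\sim\ \longrightarrow\ \mathcal{F}(A,E),\qquad \overline{r}\mapsto B_r,$$ is a bijection between $\mathcal{HC}^2(B,A)$ and the set of isomorphism classes of all $A$-complements of $E$. In particular, the factorization index $[E:A]:=|\mathcal{F}(A,E)|$ of $A$ in $E$ equals $|\mathcal{HC}^2(B,A)|$.
   Context: An alternative algebra is a vector space with a bilinear multiplication $\circ$ such that, with $(x,y,z)=(x\circ y)\circ z-x\circ(y\circ z)$, one has $(x,y,z)=-(y,x,z)$ and $(x,y,z)=-(x,z,y)$ for all $x,y,z$. An alternative subalgebra $B$ of $E$ is called an $A$-complement of $E$ if $E=A\oplus B$ as vector spaces. $\mathcal{F}(A,E)$ is the set of isomorphism classes (as alternative algebras) of all $A$-complements in $E$. Associated matched pair: for an $A$-complement $B$, define bilinear maps $\triangleright:A\times B\to B$, $\triangleleft:B\times A\to B$, $\rightharpoonup:B\times A\to A$, $\leftharpoonup:A\times B\to A$ by decomposing products in $E=A\oplus B$: $x\circ u=x\leftharpoonup u+x\triangleright u$ and $u\circ x=u\rightharpoonup x+u\triangleleft x$ for $x\in A$, $u\in B$. Then $E$ is identified with the bicrossed product $A\bowtie B$, i.e. $A\oplus B$ with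 $(x,u)\bullet(y,v)=(x\circ y+u\rightharpoonup y+x\leftharpoonup v,\ u\circ v+x\triangleright v+u\triangleleft y)$. A deformation map of the matched pair is a linear map $r:B\to A$ with $$r(u\circ v)-r(u)\circ r(v)=u\rightharpoonup r(v)+r(u)\leftharpoonup v-r\big(r(u)\triangleright v+u\triangleleft r(v)\big)\quad\text{for all }u,v\in B.$$ $\mathcal{DM}(B,A)$ is the set of all deformation maps. For $r\in\mathcal{DM}(B,A)$, $B_r$ is the vector space $B$ with product $u\circ_r v=u\circ v+r(u)\triangleright v+u\triangleleft r(v)$; it is an alternative algebra, isomorphic via $u\mapsto (r(u),u)$ to an $A$-complement of $E$, and in the map above $B_r$ stands for its isomorphism class. Two deformation maps $r,r':B\to A$ are equivalent, $r\sim r'$, if there exists a linear automorphism $\sigma:B\to B$ such that for all $u,v\in B$: $$\sigma(u\circ v)-\sigma(u)\circ\sigma(v)=\sigma(u)\triangleleft r'(\sigma(v))+r'(\sigma(u))\triangleright\sigma(v)-\sigma(u\triangleleft r(v))-\sigma(r(u)\triangleright v).$$ *)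

(* Defs.v *)
From HB Require Import structures.
From mathcomp Require Import all_boot all_order all_algebra sesquilinear.
From mathcomp Require Import boolp classical_sets functions cardinality.

Set Implicit Arguments.
Unset Strict Implicit.
Unset Printing Implicit Defensive.

Import GRing.Theory.
Local Open Scope ring_scope.

Definition associator (V : zmodType) (mul : V -> V -> V) (x y z : V) : V :=
  mul (mul x y) z - mul x (mul y z).

HB.mixin Record Lmodule_isAltAlgebra (K : fieldType) V of GRing.Lmodule K V := {
  alt_mul : V -> V -> V;
  alt_mul_bilinear : bilinear_for *:%R *:%R alt_mul;
  alt_associatorC : forall x y z,
    associator alt_mul x y z = - associator alt_mul y x z;
  alt_associatorAC : forall x y z,
    associator alt_mul x y z = - associator alt_mul x z y }.

#[short(type="altAlgType")]
HB.structure Definition AltAlgebra (K : fieldType) :=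
  {V of GRing.Lmodule K V & Lmodule_isAltAlgebra K V}.

Declare Scope alt_scope.
Delimit Scope alt_scope with alt.
Open Scope alt_scope.

Notation "x ** y" := (alt_mul x y)
  (at level 40, left associativity) : alt_scope.

HB.instance Definition _ (K : fieldType) (V : altAlgType K) :=
  bilinear_isBilinear.Build K V V V *:%R *:%R (@alt_mul K V)
    (@alt_mul_bilinear K V).

Lemma alt_mulDl (K : fieldType) (V : altAlgType K) (x y z : V) :
  (x + y) ** z = x ** z + y ** z.
Proof. exact: linearDl. Qed.

Lemma alt_mulDr (K : fieldType) (V : altAlgType K) (x y z : V) :
  x ** (y + z) = x ** y + x ** z.
Proof. exact: linearDr. Qed.

Definition alt_isomorphic (K : fieldType) (S T : altAlgType K) : Prop :=
  exists f : {linear S -> T}, bijective f /\ {morph f : x y / x ** y}.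

HB.mixin Record isAltMulClosed (K : fieldType) (E : altAlgType K)
    (S : {pred E}) := {
  alt_mul_closed : {in S &, forall x y, x ** y \in S} }.

#[short(type="altSubalgebra")]
HB.structure Definition AltSubalgebra (K : fieldType) (E : altAlgType K) :=
  {S of GRing.SubmodClosed K S & isAltMulClosed K E S}.

Record subalg (K : fieldType) (E : altAlgType K) (S : altSubalgebra E) :=
  Subalg { subalg_val : E; subalg_valP : subalg_val \in S }.

Section Subalg.
Variables (K : fieldType) (E : altAlgType K) (S : altSubalgebra E).

HB.instance Definition _ := [isSub for @subalg_val K E S].
HB.instance Definition _ := [Choice of subalg S by <:].
HB.instance Definition _ := [SubChoice_isSubLmodule of subalg S by <:].

Definition subalg_mul (x y : subalg S) : subalg S :=
  Subalg (alt_mul_closed _ _ (subalg_valP x) (subalg_valP y)).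

Lemma subalg_mul_bilinear : bilinear_for *:%R *:%R subalg_mul.
Proof.
split=> x k u v; apply: val_inj; rewrite linearP /=;
  [exact: alt_mul_bilinear.1 | exact: alt_mul_bilinear.2].
Qed.

Lemma val_subalg_associator x y z :
  val (associator subalg_mul x y z)
  = associator (@alt_mul K E) (val x) (val y) (val z).
Proof. by rewrite /associator raddfB. Qed.

Lemma subalg_associatorC x y z :
  associator subalg_mul x y z = - associator subalg_mul y x z.
Proof.
apply: val_inj.
by rewrite raddfN !val_subalg_associator alt_associatorC.
Qed.

Lemma subalg_associatorAC x y z :
  associator subalg_mul x y z = - associator subalg_mul x z y.
Proof.
apply: val_inj.
by rewrite raddfN !val_subalg_associator alt_associatorAC.
Qed.

HB.instance Definition _ := Lmodule_isAltAlgebra.Build K (subalg S)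
  subalg_mul_bilinear subalg_associatorC subalg_associatorAC.

End Subalg.

Record alt_complement (K : fieldType) (E : altAlgType K) (A : altSubalgebra E) :=
  AltComplement {
    complement_subalg :> altSubalgebra E;
    complement_cap : forall x, x \in A -> x \in complement_subalg -> x = 0;
    complement_sum : forall x,
      exists2 a, a \in A & x - a \in complement_subalg }.

Section MatchedPair.
Variables (K : fieldType) (E : altAlgType K).
Variables (A : altSubalgebra E) (B : alt_complement A).

Lemma proj_subproof x : exists a, (a \in A) && (x - a \in B).
Proof. by have [a aA aB] := complement_sum B x; exists a; apply/andP. Qed.

(* The two components of x in the decomposition of E as the direct sum of A
   and B. *)
Definition projA (x : E) : subalg A :=
  Subalg (andP (xchooseP (proj_subproof x))).1.
Definition projB (x : E) : subalg B :=
  Subalg (andP (xchooseP (proj_subproof x))).2.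

Lemma projAB x : val (projA x) + val (projB x) = x.
Proof. by rewrite /= addrC subrK. Qed.

Lemma proj_unique (a a' : subalg A) (b b' : subalg B) :
  val a + val b = val a' + val b' -> a = a' /\ b = b'.
Proof.
move=> e.
have e0 : val (a - a') = val (b' - b).
  rewrite !raddfB; apply/eqP.
  by rewrite subr_eq addrAC eq_sym subr_eq eq_sym e addrC.
have z : val (a - a') = 0.
  by apply: (@complement_cap _ _ _ B); [exact: valP | rewrite e0; exact: valP].
have za : a - a' = 0 by apply: val_inj; exact: etrans z _.
have zb : b' - b = 0 by apply: val_inj; exact: etrans (etrans (esym e0) z) _.
by split; [apply/subr0_eq | apply/esym/subr0_eq].
Qed.

Lemma proj_linear k x y :
  projA (k *: x + y) = k *: projA x + projA y /\
  projB (k *: x + y) = k *: projB x + projB y.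
Proof.
apply: proj_unique; rewrite projAB !linearP /= addrACA -scalerDr.
by rewrite -[in LHS](projAB x) -[in LHS](projAB y).
Qed.

HB.instance Definition _ := GRing.isLinear.Build K E (subalg A) *:%R projA
  (fun k x y => (proj_linear k x y).1).
HB.instance Definition _ := GRing.isLinear.Build K E (subalg B) *:%R projB
  (fun k x y => (proj_linear k x y).2).

(* With x in A and u in B, mp_rtri x u, mp_ltri u x, mp_rharp u x and
   mp_lharp x u are respectively x |> u, u <| x (with values in B) and the
   right and left harpoons of the matched pair (with values in A). *)
Definition mp_rtri (x : subalg A) (u : subalg B) : subalg B :=
  projB (val x ** val u).
Definition mp_ltri (u : subalg B) (x : subalg A) : subalg B :=
  projB (val u ** val x).
Definition mp_rharp (u : subalg B) (x : subalg A) : subalg A :=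
  projA (val u ** val x).
Definition mp_lharp (x : subalg A) (u : subalg B) : subalg A :=
  projA (val x ** val u).

Definition is_deformation_map (r : {linear subalg B -> subalg A}) : Prop :=
  forall u v : subalg B,
    r (u ** v) - r u ** r v
    = mp_rharp u (r v) + mp_lharp (r u) v
      - r (mp_rtri (r u) v + mp_ltri u (r v)).

Record deformation_map := DeformationMap {
  deformation_fun :> {linear subalg B -> subalg A};
  deformation_mapP : is_deformation_map deformation_fun }.

Definition deformed (r : deformation_map) : Type := subalg B.

Section Deformed.
Variable r : deformation_map.

HB.instance Definition _ := GRing.Lmodule.copy (deformed r) (subalg B).

Definition deformed_mul (u v : deformed r) : deformed r :=
  (u : subalg B) ** v + mp_rtri (r u) v + mp_ltri u (r v).

Definition deformed_graph (u : deformed r) : E :=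
  val (r u) + val (u : subalg B).

Lemma deformed_graph_linear : linear deformed_graph.
Proof.
by move=> k u v; rewrite /deformed_graph !linearP /= addrACA -scalerDr.
Qed.

HB.instance Definition _ := GRing.isLinear.Build K (deformed r) E *:%R
  deformed_graph deformed_graph_linear.

Lemma deformed_graph_inj : injective deformed_graph.
Proof. by move=> u v /proj_unique[]. Qed.

Lemma deformed_graphM : {morph deformed_graph : u v /
  deformed_mul u v >-> u ** v}.
Proof.
move=> u v; rewrite /deformed_graph /deformed_mul.
have -> : r ((u : subalg B) ** v + mp_rtri (r u) v + mp_ltri u (r v))
  = r u ** r v + (mp_rharp u (r v) + mp_lharp (r u) v).
  have /eqP := deformation_mapP r u v; rewrite subr_eq => /eqP e.
  by rewrite -addrA linearD e addrAC subrK addrC.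
have eAB := projAB (val (r u) ** val v).
have eBA := projAB (val u ** val (r v)).
rewrite alt_mulDl !alt_mulDr -eAB -eBA !raddfD.
have ac (p l t h s q : E) :
    p + (h + l) + (q + t + s) = p + (l + t) + (h + s + q).
  by rewrite !addrA [RHS](ACl (1*4*2*6*3*5)).
exact: ac.
Qed.
Lemma deformed_mul_bilinear : bilinear_for *:%R *:%R deformed_mul.
Proof.
split=> x k u v; apply: deformed_graph_inj;
  rewrite deformed_graphM !deformed_graph_linear !deformed_graphM.
  exact: (alt_mul_bilinear.1 (deformed_graph x)).
exact: (alt_mul_bilinear.2 (deformed_graph x)).
Qed.

Lemma deformed_graph_associator x y z :
  deformed_graph (associator deformed_mul x y z)
  = associator (@alt_mul K E)
      (deformed_graph x) (deformed_graph y) (deformed_graph z).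
Proof. by rewrite /associator raddfB /= !deformed_graphM. Qed.

Lemma deformed_associatorC x y z :
  associator deformed_mul x y z = - associator deformed_mul y x z.
Proof.
apply: deformed_graph_inj.
by rewrite raddfN /= !deformed_graph_associator alt_associatorC.
Qed.

Lemma deformed_associatorAC x y z :
  associator deformed_mul x y z = - associator deformed_mul x z y.
Proof.
apply: deformed_graph_inj.
by rewrite raddfN /= !deformed_graph_associator alt_associatorAC.
Qed.

HB.instance Definition _ := Lmodule_isAltAlgebra.Build K (deformed r)
  deformed_mul_bilinear deformed_associatorC deformed_associatorAC.

End Deformed.

Definition deformation_equiv (r r' : deformation_map) : Prop :=
  exists2 sigma : {linear subalg B -> subalg B}, bijective sigma &
    forall u v : subalg B,
      sigma (u ** v) - sigma u ** sigma v
      = mp_ltri (sigma u) (r' (sigma v)) + mp_rtri (r' (sigma u)) (sigma v)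
        - sigma (mp_ltri u (r v)) - sigma (mp_rtri (r u) v).

End MatchedPair.

Local Open Scope classical_set_scope.

(* Quotient sets are represented as sets of equivalence classes. *)

Definition deformation_class (K : fieldType) (E : altAlgType K)
    (A : altSubalgebra E) (B : alt_complement A) (r : deformation_map B) :
    set (deformation_map B) :=
  [set r' | deformation_equiv r r'].

Definition HC2 (K : fieldType) (E : altAlgType K) (A : altSubalgebra E)
    (B : alt_complement A) : set (set (deformation_map B)) :=
  range (@deformation_class K E A B).
Arguments HC2 {K E A} B _.

(* The isomorphism class of the alternative algebra T, cut down to the
   A-complements of E. *)
Definition iso_class (K : fieldType) (E : altAlgType K)
    (A : altSubalgebra E) (T : altAlgType K) : set (alt_complement A) :=
  [set C : alt_complement A | alt_isomorphic T (subalg C)].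
Arguments iso_class {K E} A T _.

Definition complement_classes (K : fieldType) (E : altAlgType K)
    (A : altSubalgebra E) : set (set (alt_complement A)) :=
  range (fun C : alt_complement A => iso_class A (subalg C)).
Arguments complement_classes {K E} A _.

(* Main.v *)
Require Import Defs.
From Stdlib Require Import RelationClasses.
From mathcomp Require Import all_boot all_order all_algebra.
From mathcomp Require Import boolp classical_sets functions cardinality.
From HB Require Import structures.
Import GRing.Theory.
Local Open Scope ring_scope.
Local Open Scope classical_set_scope.
Local Open Scope card_scope.

Set Implicit Arguments.
Unset Strict Implicit.
Unset Printing Implicit Defensive.

(** The graph of a linear map r : B -> A is the set of all r u + u in E. Such
    graphs are exactly the linear complements of A in E. Expanding
    (r u + u) ** (r v + v) along E = A + B (graph_mulE) shows that the graph is
    closed under multiplication if and only if r is a deformation map, and that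
    u |-> r u + u then carries the product of the deformed algebra B_r to that
    of E. So every B_r is isomorphic to an A-complement, its graph
    (graph_complement_iso), and every A-complement C is the graph of a
    deformation map (complement_is_deformed); this map is slope C, the negated
    restriction to B of the projection onto A along C.

    On the other side, transposing terms in the equation that defines r ~ r'
    turns it into the multiplicativity of sigma : B_r -> B_r'
    (deformation_equivP). Hence ~ is the isomorphism relation between deformed
    algebras: it is an equivalence relation, and sending the class of r to the
    isomorphism class of B_r is well defined and injective. It is onto because
    every complement is a graph.

    Isomorphism classes are represented by sets of complements. The class of
    B_r contains the graph of r, so it is never empty; this is what makes
    equality of two such sets imply that the algebras are isomorphic
    (iso_classP). *)

(** * Isomorphism of alternative algebras *)

Section Isomorphism.
Variable K : fieldType.
Implicit Types S T U : altAlgType K.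

Lemma alt_isomorphic_refl S : alt_isomorphic S S.
Proof. by exists idfun; split=> //; exists idfun. Qed.

Lemma alt_isomorphic_sym S T : alt_isomorphic S T -> alt_isomorphic T S.
Proof.
move=> [f [[g fK gK] fM]].
have glin : linear g by move=> k x y; rewrite -{1}(gK x) -{1}(gK y) -linearP fK.
pose g' := GRing.isLinear.Build K T S *:%R g glin.
pose gl : {linear T -> S} := HB.pack g g'.
exists gl; split; first by exists f.
by move=> x y /=; rewrite -{1}(gK x) -{1}(gK y) -fM fK.
Qed.

Lemma alt_isomorphic_trans S T U :
  alt_isomorphic S T -> alt_isomorphic T U -> alt_isomorphic S U.
Proof.
move=> [f [fb fM]] [g [gb gM]]; exists (g \o f); split; first exact: bij_comp.
by move=> x y /=; rewrite fM gM.
Qed.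

Lemma eq_iso_class (E : altAlgType K) (A : altSubalgebra E) S T :
  alt_isomorphic S T -> iso_class A S = iso_class A T.
Proof.
move=> ST; apply/seteqP; split=> C /=; last exact: alt_isomorphic_trans.
exact/alt_isomorphic_trans/alt_isomorphic_sym.
Qed.

End Isomorphism.

(** * Deformation maps and isomorphisms of their algebras *)

Lemma altSubalgebraB (K : fieldType) (E : altAlgType K) (S : altSubalgebra E) :
  {in S &, forall x y, x - y \in S}.
Proof. by move=> x y xS yS; rewrite -scaleN1r rpredD ?rpredZ. Qed.

Section Complements.
Variables (K : fieldType) (E : altAlgType K) (A : altSubalgebra E).

Section Deformation.
Variable B : alt_complement A.
Implicit Types r : deformation_map B.

(** The two sides differ only by moving the terms subtracted in the definition
    of the equivalence across the equality: B_r and B_r' share the carrier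
    space B, so the same sigma serves in both. *)
Lemma deformation_equivP r r' :
  deformation_equiv r r' <-> alt_isomorphic (deformed r) (deformed r').
Proof.
have eqv (V : zmodType) (s p t1 t2 s1 s2 : V) :
    (s - p == t1 + t2 - s1 - s2) = (s + s2 + s1 == p + t2 + t1).
  rewrite eq_sym !subr_eq eq_sym -[_ + s2 + s1]addrA addrAC subr_eq.
  by rewrite -addrA (addrC _ p) (addrC t1) !addrA.
split.
- move=> [s sb sM]; exists (s : {linear deformed r -> deformed r'}); split=> //.
  move=> u v; move: (sM u v) => /eqP; rewrite eqv => /eqP.
  by rewrite -!linearD.
- move=> [s [sb sM]]; exists (s : {linear subalg B -> subalg B}) => // u v.
  by apply/eqP; rewrite eqv; apply/eqP; rewrite -!linearD; exact: sM.
Qed.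

(** The A- and B-components of the product of two points of a graph: comparing
    the first with r applied to the second gives the deformation equation. *)
Lemma graph_mulE (r : {linear subalg B -> subalg A}) (u v : subalg B) :
  (val (r u) + val u) ** (val (r v) + val v) =
  val (r u ** r v + (mp_rharp u (r v) + mp_lharp (r u) v))
  + val (u ** v + mp_rtri (r u) v + mp_ltri u (r v)).
Proof.
have eAB := projAB B (val (r u) ** val v).
have eBA := projAB B (val u ** val (r v)).
rewrite alt_mulDl !alt_mulDr -eAB -eBA !raddfD.
have ac (p l t h s q : E) :
    p + (l + t) + (h + s + q) = p + (h + l) + (q + t + s).
  by rewrite !addrA [LHS](ACl (1*4*2*6*3*5)).
exact: ac.
Qed.

Lemma proj_sum (a : subalg A) (b : subalg B) :
  projA B (val a + val b) = a /\ projB B (val a + val b) = b.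
Proof. by apply: proj_unique; rewrite projAB. Qed.

(** Two complements of A, one inside the other, coincide. So a complement that
    contains the graph of r is that graph, and u |-> r u + u maps B_r onto it,
    with the projection onto B as inverse. *)
Lemma deformed_iso r (C : alt_complement A) :
  (forall u : deformed r, deformed_graph u \in C) ->
  alt_isomorphic (deformed r) (subalg C).
Proof.
move=> gC.
pose g (u : deformed r) : subalg C := Subalg (gC u).
have glin : linear g.
  by move=> k u v; apply: val_inj; rewrite /= linearP.
pose g' := GRing.isLinear.Build K (deformed r) (subalg C) *:%R g glin.
pose gl : {linear deformed r -> subalg C} := HB.pack g g'.
exists gl; split; last first.
  by move=> u v; apply: val_inj; exact: deformed_graphM.
exists (fun w : subalg C => projB B (val w) : deformed r).
  by move=> u; exact: (proj_sum _ _).2.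
move=> w; apply: (@val_inj E); apply/subr0_eq.
apply: (@complement_cap _ _ _ C); last exact: altSubalgebraB (valP _) (valP _).
(* The graph point above the B-component of w differs from w by an element of
   A, which also lies in C. *)
have -> : val (gl (projB B (val w))) - val w
    = val (r (projB B (val w))) - val (projA B (val w)).
  rewrite -[X in _ - X](projAB B (val w)).
  have addBB (V : zmodType) (x y z : V) : x + z - (y + z) = x - y.
    by rewrite opprD addrACA subrr addr0.
  exact: addBB.
exact: altSubalgebraB (valP _) (valP _).
Qed.

(** * The graph of a deformation map is a complement *)

Definition graph_pred r : {pred E} := [pred x | projA B x == r (projB B x)].

Lemma graph_predP r x :
  reflect (exists u : deformed r, x = deformed_graph u) (x \in graph_pred r).
Proof.
apply: (iffP eqP) => [e|[u ->]].
  by exists (projB B x); rewrite /deformed_graph -e projAB.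
by rewrite /deformed_graph (proj_sum _ _).1 (proj_sum _ _).2.
Qed.

Lemma graph_submod_closed r : submod_closed (graph_pred r).
Proof.
split=> [|k _ _ /graph_predP[u ->] /graph_predP[v ->]]; apply/graph_predP.
  by exists 0; rewrite raddf0.
by exists (k *: u + v); rewrite linearP.
Qed.

Lemma graph_mul_closed r :
  {in graph_pred r &, forall x y, x ** y \in graph_pred r}.
Proof.
move=> _ _ /graph_predP[u ->] /graph_predP[v ->]; apply/graph_predP.
by exists (u ** v); rewrite deformed_graphM.
Qed.

HB.instance Definition _ r :=
  GRing.isSubmodClosed.Build K E (graph_pred r) (graph_submod_closed r).
HB.instance Definition _ r :=
  isAltMulClosed.Build K E (graph_pred r) (@graph_mul_closed r).

Lemma graph_cap r x : x \in A -> x \in graph_pred r -> x = 0.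
Proof.
move=> xA /graph_predP[u e].
have : val (Subalg xA) + val (0 : subalg B) = val (r u) + val u.
  by rewrite raddf0 addr0.
by move=> /proj_unique[_ u0]; rewrite e -u0 raddf0.
Qed.

Lemma graph_sum r x : exists2 a, a \in A & x - a \in graph_pred r.
Proof.
exists (val (projA B x - r (projB B x))); first exact: valP.
apply/graph_predP; exists (projB B x).
by rewrite -[X in X - _](projAB B) [val (_ - _)]raddfB opprB addrC addrA subrK.
Qed.

Definition graph_complement r : alt_complement A :=
  @AltComplement K E A (graph_pred r) (@graph_cap r) (@graph_sum r).

Lemma graph_complement_iso r :
  alt_isomorphic (deformed r) (subalg (graph_complement r)).
Proof. by apply: deformed_iso => u; apply/graph_predP; exists u. Qed.

(** * Every complement is the graph of a deformation map *)

Section GraphOfComplement.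
Variable C : alt_complement A.

(** Writing u = a + c with a in A and c in C gives c = - a + u: the point of C
    above u has A-component - a. *)
Definition slope (u : subalg B) : subalg A := - projA C (val u).

Lemma slope_linear : linear slope.
Proof.
move=> k u v.
by rewrite /slope [val (_ + _)]linearP [projA C _]linearP opprD scalerN.
Qed.

HB.instance Definition _ :=
  GRing.isLinear.Build K (subalg B) (subalg A) *:%R slope slope_linear.

Lemma slope_graph_mem u : val (slope u) + val u \in C.
Proof.
by rewrite -[X in _ + X](projAB C) [val (- _)]raddfN addKr; exact: valP.
Qed.

(** Two points of C with the same B-component differ by an element of A, hence
    are equal. *)
Lemma slope_unique (a : subalg A) (b : subalg B) :
  val a + val b \in C -> a = slope b.
Proof.
move=> abC; apply: val_inj; apply/subr0_eq.
apply: (@complement_cap _ _ _ C); first exact: altSubalgebraB (valP _) (valP _).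
have -> : val a - val (slope b)
    = val a + val b - (val (slope b) + val b).
  by rewrite opprD addrACA subrr addr0.
by rewrite altSubalgebraB // slope_graph_mem.
Qed.

(** C is closed under multiplication, so the product of two points of the graph
    of slope is again on that graph. *)
Lemma slope_deformation : is_deformation_map slope.
Proof.
move=> u v.
have : (val (slope u) + val u) ** (val (slope v) + val v) \in C.
  by apply: alt_mul_closed; exact: slope_graph_mem.
rewrite graph_mulE => /slope_unique.
have slopeD (x y : subalg B) : slope (x + y) = slope x + slope y.
  exact: linearD.
rewrite -addrA slopeD => e.
by apply: (canRL (addrK _)); rewrite addrAC -e addrC addKr.
Qed.

Lemma complement_is_deformed :
  exists r, alt_isomorphic (deformed r) (subalg C).
Proof.
exists (DeformationMap slope_deformation).
by apply: deformed_iso; exact: slope_graph_mem.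
Qed.

End GraphOfComplement.

(** * The bijection between classes *)

(** The graph of r witnesses that the class of B_r is inhabited, so equal
    classes share a complement to which both algebras are isomorphic. *)
Lemma iso_classP r r' :
  iso_class A (deformed r) = iso_class A (deformed r') <->
  alt_isomorphic (deformed r) (deformed r').
Proof.
split=> [e|]; last exact: eq_iso_class.
have : iso_class A (deformed r') (graph_complement r).
  by rewrite -e; exact: graph_complement_iso.
by move=> /alt_isomorphic_sym; apply/alt_isomorphic_trans/graph_complement_iso.
Qed.

Lemma deformation_equiv_equivalence : Equivalence (@deformation_equiv K E A B).
Proof.
split=> [r|r r'|r r' r''].
- by apply/deformation_equivP; exact: alt_isomorphic_refl.
- by move=> /deformation_equivP rr'; apply/deformation_equivP/alt_isomorphic_sym.
- move=> /deformation_equivP rr' /deformation_equivP r'r''.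
  by apply/deformation_equivP; exact: alt_isomorphic_trans r'r''.
Qed.

(** Taking the union over all representatives avoids choosing one; on a genuine
    equivalence class all members of the union are equal. *)
Definition class_map (X : set (deformation_map B)) : set (alt_complement A) :=
  \bigcup_(r in X) iso_class A (deformed r).

Lemma class_mapE r : class_map (deformation_class r) = iso_class A (deformed r).
Proof.
apply/seteqP; split=> [C [r' /deformation_equivP rr'] r'C|C rC].
  by rewrite ((iso_classP r r').2 rr').
by exists r => //; apply/deformation_equivP; exact: alt_isomorphic_refl.
Qed.

Lemma class_map_bij : set_bij (HC2 B) (complement_classes A) class_map.
Proof.
split.
- move=> _ [r _ <-]; rewrite class_mapE; exists (graph_complement r) => //.
  exact/esym/eq_iso_class/graph_complement_iso.
- move=> X Y /set_mem[r _ <-] /set_mem[r' _ <-].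
  rewrite !class_mapE => /iso_classP/deformation_equivP rr'.
  have [_ sym trans] := deformation_equiv_equivalence.
  apply/seteqP; split=> r1 /=; last exact: trans.
  exact/trans/sym.
- move=> _ [C _ <-]; have [r rC] := complement_is_deformed C.
  exists (deformation_class r); first by exists r.
  by rewrite class_mapE; exact: eq_iso_class.
Qed.

End Deformation.
End Complements.

Theorem theorem4p9 (K : closedFieldType)
  (char2 : 2%N \notin [pchar K]) (char3 : 3%N \notin [pchar K])
  (E : altAlgType K) (A : altSubalgebra E) (B : alt_complement A) :
  [/\ Equivalence (@deformation_equiv K E A B),
      (exists f : set (deformation_map B) -> set (alt_complement A),
         (forall r : deformation_map B,
            f (deformation_class r) = iso_class A (deformed r)) /\
         set_bij (HC2 B) (complement_classes A) f)
    & complement_classes A #= HC2 B].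
Proof.
split.
- exact: deformation_equiv_equivalence.
- exists (@class_map K E A B).
  by split; [exact: class_mapE | exact: class_map_bij].
- rewrite card_eq_sym; apply/card_set_bijP; exists (@class_map K E A B).
  exact: class_map_bij.
Qed.
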